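(* Fix $\beta > 0$ and integers $n,p$ such that $1 < p < n$. Suppose the columns of the random matrix $S \in \mathbb{R}^{n\times p}$ are chosen uniformly at random from $\{e_1,\dots,e_n\}$ without replacement. Let $A_{1,\beta} = I + \frac{\beta}{n}\mathbf{1}_n\mathbf{1}_n^{T}\in\mathbb{R}^{n\times n}$ and $\mu_{\mathrm{rand}} = \lambda_{\min}\big(\mathbb{E}[P_{A_{1,\beta}^{1/2}S}]\big)$. Then $$\mu_{\mathrm{rand}} = \frac{p}{n+\beta p} + \frac{(p-1)\beta p}{(n-1)(n+\beta p)}.$$
   Context: $\mathbf{1}_n \in \mathbb{R}^n$ is the all-ones vector and $e_i$ is the $i$-th standard basis vector of $\mathbb{R}^n$. For a matrix $M$, $P_M$ denotes the orthogonal projector onto the range of $M$; for positive semi-definite $M$, $M^{1/2}$ is its positive semi-definite square root; $\lambda_{\min}$ denotes the smallest eigenvalue. *)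

(* Defs.v *)
From HB Require Import structures.
From mathcomp Require Import all_boot all_order all_algebra.
From mathcomp Require Import all_classical all_reals all_analysis.
From mathcomp Require Import ring lra.

Set Implicit Arguments.
Unset Strict Implicit.
Unset Printing Implicit Defensive.

Import Order.TTheory GRing.Theory Num.Theory.
Local Open Scope classical_set_scope.
Local Open Scope ring_scope.

Definition ones (R : realType) (n : nat) : 'cV[R]_n := const_mx 1.

Definition std_basis (R : realType) (n : nat) (i : 'I_n) : 'cV[R]_n :=
  delta_mx i 0.

Definition A1 (R : realType) (n : nat) (beta : R) : 'M[R]_n :=
  1%:M + (beta / n%:R) *: (ones R n *m (ones R n)^T).

(* MathComp's subspaces are row spaces and its projectors act on row vectors:
   the range (column space) of M is the row space of M^T, and its orthogonal
   complement {u | u *m M = 0} is kermx M. Transposing gives the matrix acting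
   on column vectors; see orthoprojP. *)
Definition orthoproj (R : realType) (m n : nat) (M : 'M[R]_(m, n)) : 'M[R]_m :=
  (proj_mx << M^T >>%MS (kermx M))^T.

Definition psd (R : realType) (n : nat) (M : 'M[R]_n) : Prop :=
  M^T = M /\ forall x : 'cV[R]_n, 0 <= (x^T *m M *m x) 0 0.

(* Uniqueness is psd_sqrt_unique; the value is 0 if there is no such matrix. *)
Definition psd_sqrt (R : realType) (n : nat) (M : 'M[R]_n) : 'M[R]_n :=
  xget 0 [set B : 'M[R]_n | psd B /\ B *m B = M].

(* The value is 0 if M has no real eigenvalue. *)
Definition lambda_min (R : realType) (n : nat) (M : 'M[R]_n) : R :=
  xget 0 [set a : R | eigenvalue M a /\ forall b, eigenvalue M b -> a <= b].

Definition expectation_mx (d : measure_display) (T : measurableType d)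
    (R : realType) (P : probability T R) (m n : nat) (X : T -> 'M[R]_(m, n)) :
    'M[R]_(m, n) :=
  \matrix_(i, j) fine ('E_P[fun w => X w i j])%E.

Definition column_selection (R : realType) (n p : nat)
    (f : {ffun 'I_p -> 'I_n}) : 'M[R]_(n, p) :=
  \matrix_(i, j) std_basis R (f j) i 0.

(* Sampling without replacement: the ordered p-tuple of column indices is
   uniform over the injective maps from 'I_p to 'I_n. *)
Definition uniform_columns_without_replacement
    (d : measure_display) (T : measurableType d) (R : realType)
    (P : probability T R) (n p : nat) (S : T -> 'M[R]_(n, p)) : Prop :=
  let inj := [set f : {ffun 'I_p -> 'I_n} | injectiveb f]%SET in
  (forall w, exists2 f, f \in inj & S w = column_selection R f) /\
  (forall f, f \in inj ->
     measurable [set w | S w = column_selection R f] /\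
     P [set w | S w = column_selection R f] = ((#|inj|%:R)^-1 : R)%:E).

Section Facts.
Variable R : realType.

Lemma mulmx_tr_eq0 (m n : nat) (A : 'M[R]_(m, n)) : A *m A^T = 0 -> A = 0.
Proof.
move=> A0; apply/matrixP => i j; rewrite mxE.
have := congr1 (fun B : 'M[R]_m => B i i) A0; rewrite !mxE.
under eq_bigr do rewrite mxE -expr2.
move=> /psumr_eq0P => /(_ (fun k _ => sqr_ge0 (A i k))) /(_ j isT) /eqP.
by rewrite sqrf_eq0 => /eqP.
Qed.

Lemma cap_range_ker (m n : nat) (M : 'M[R]_(m, n)) :
  (<< M^T >> :&: kermx M)%MS = 0.
Proof.
apply/eqP; rewrite -submx0; apply/row_subP => i.
set u := row i _.
have : (u <= << M^T >> :&: kermx M)%MS by exact: row_sub.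
rewrite sub_capmx genmxE => /andP[/submxP[v uE] /sub_kermxP uM0].
rewrite submx0; apply/eqP; apply: mulmx_tr_eq0.
by rewrite {2}uE trmx_mul trmxK mulmxA uM0 mul0mx.
Qed.

Lemma tr_idem_sym (F : comPzRingType) (n : nat) (Q : 'M[F]_n) :
  Q^T = Q *m Q^T -> Q^T = Q.
Proof. by move=> QQt; rewrite -[RHS]trmxK [in RHS]QQt trmx_mul trmxK. Qed.

Lemma orthoprojP (m n : nat) (M : 'M[R]_(m, n)) :
  [/\ (orthoproj M)^T = orthoproj M,
      orthoproj M *m orthoproj M = orthoproj M &
      ((orthoproj M)^T :=: M^T)%MS].
Proof.
rewrite /orthoproj trmxK; set Q := proj_mx _ _.
have QQ : Q *m Q = Q by apply: proj_mx_proj; exact: cap_range_ker.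
have full : (1%:M <= << M^T >> + kermx M)%MS.
  rewrite sub1mx /row_full; apply/eqP.
  have := mxrank_sum_cap << M^T >>%MS (kermx M).
  rewrite cap_range_ker mxrank0 addn0 => ->.
  by rewrite genmxE mxrank_tr mxrank_ker subnKC // rank_leq_row.
have Qker : (1%:M - Q) *m M = 0.
  by apply/sub_kermxP; have := proj_mx_compl_sub full; rewrite mul1mx.
have Qsub : (Q <= M^T)%MS.
  by have := proj_mx_sub << M^T >>%MS (kermx M) 1%:M; rewrite mul1mx genmxE.
have QQt : Q^T = Q *m Q^T.
  apply/eqP; rewrite -subr_eq0 -{1}[Q^T]mul1mx -mulmxBl; apply/eqP.
  by case/submxP: Qsub => D {2}->; rewrite trmx_mul trmxK mulmxA Qker mul0mx.
have Qt : Q^T = Q by exact: tr_idem_sym QQt.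
split => //; first by rewrite Qt QQ.
apply/eqmxP; rewrite Qsub /= -{1}[M^T](_ : M^T *m Q = M^T) ?submxMl //.
by rewrite proj_mx_id ?cap_range_ker // genmxE.
Qed.

Lemma psd_ker (n : nat) (B : 'M[R]_n) (x : 'cV[R]_n) :
  psd B -> (x^T *m B *m x) 0 0 = 0 -> B *m x = 0.
Proof.
move=> [Bt Bge0] Bx0; set y := B *m x.
have yt : y^T = x^T *m B by rewrite trmx_mul Bt.
pose a : R := (y^T *m y) 0 0; pose b : R := (y^T *m B *m y) 0 0.
have quad t : 0 <= t * a *+ 2 + t ^+ 2 * b.
  suff -> : t * a *+ 2 + t ^+ 2 * b =
    ((x + t *: y)^T *m B *m (x + t *: y)) 0 0 by exact: Bge0.
  have -> : (x + t *: y)^T = x^T + t *: y^T by rewrite linearD linearZ.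
  rewrite !mulmxDl !mulmxDr -!scalemxAl -!scalemxAr.
  rewrite -[y^T *m B *m x]mulmxA -/y -yt.
  have mxD (V W : 'M[R]_1) : (V + W) 0 0 = V 0 0 + W 0 0 by rewrite mxE.
  have mxZ c (V : 'M[R]_1) : (c *: V) 0 0 = c * V 0 0 by rewrite mxE.
  rewrite !mxD !mxZ yt Bx0 -yt -/a -/b.
  by ring.
have b0 : 0 <= b by exact: Bge0.
have b1 : 0 < b + 1 by rewrite ltr_wpDl.
have a0 : a = 0.
  apply/eqP; rewrite -sqrf_eq0; apply/eqP/le_anti; rewrite sqr_ge0 andbT.
  have := quad (- a / (b + 1)).
  have -> : - a / (b + 1) * a *+ 2 + (- a / (b + 1)) ^+ 2 * b =
    - (a ^+ 2 * (b + 2)) / (b + 1) ^+ 2.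
    by field; rewrite gt_eqF.
  rewrite pmulr_lge0 ?invr_gt0 ?exprn_gt0 // oppr_ge0 pmulr_lle0 //.
  by rewrite ltr_wpDl.
have: y^T *m (y^T)^T = 0 by rewrite trmxK [LHS]mx11_scalar -/a a0 raddf0.
by move/mulmx_tr_eq0 => /(congr1 trmx); rewrite trmxK trmx0.
Qed.

Lemma psd_sqrt_unique (n : nat) (B C : 'M[R]_n) :
  psd B -> psd C -> B *m B = C *m C -> B = C.
Proof.
move=> Bp Cp BC; pose D : 'M[R]_n := B - C; pose E : 'M[R]_n := B + C.
have Dt : D^T = D by rewrite /D linearB /= Bp.1 Cp.1.
have anti : E *m D = - (D *m E).
  apply/eqP; rewrite -addr_eq0 /D /E; apply/eqP.
  rewrite !(mulmxDl, mulmxDr, mulmxN, mulNmx) BC.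
  move: (B *m C) (C *m B) (C *m C) => u v w.
  by apply/matrixP => i j; rewrite !mxE; ring.
have tr0 : \tr (D *m E *m D) = 0.
  have : \tr (D *m E *m D) = - \tr (D *m E *m D).
    by rewrite {1}mxtrace_mulC -[in RHS]mulmxA anti mulmxN raddfN opprK mulmxA.
  lra.
have colM (G K : 'M[R]_n) i : col i (G *m K) = G *m col i K.
  by rewrite !colE mulmxA.
have quadE (G : 'M[R]_n) i :
    (D *m G *m D) i i = ((col i D)^T *m G *m col i D) 0 0.
  by rewrite tr_col Dt -row_mul !mxE; apply: eq_bigr => k _; rewrite !mxE.
have DG0 (G H : 'M[R]_n) : psd G -> psd H -> G + H = E -> G *m D = 0.
  move=> Gp Hp GH.
  have DGH : D *m E *m D = D *m G *m D + D *m H *m D.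
    by rewrite -GH (mulmxDr D G H) (mulmxDl (D *m G)).
  have ge0 (K : 'M[R]_n) i : psd K -> 0 <= (D *m K *m D) i i.
    by move=> Kp; rewrite quadE; exact: Kp.2.
  have diag0 i : (D *m G *m D) i i = 0.
    have sum0 : \sum_k (D *m G *m D) k k = 0.
      apply/le_anti/andP; split; last by apply: sumr_ge0 => k _; exact: ge0.
      rewrite -[leRHS]tr0 DGH /mxtrace; apply: ler_sum => k _.
      by rewrite [leRHS]mxE lerDl ge0.
    by apply: (psumr_eq0P _ sum0) => // k _; exact: ge0.
  apply/matrixP => i j.
  have -> : (G *m D) i j = (G *m col j D) i 0 by rewrite -colM [RHS]mxE.
  have -> : G *m col j D = 0 by apply: psd_ker => //; rewrite -quadE.
  by rewrite !mxE.
have BD : B *m D = 0 by exact: (DG0 _ C).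
have CD : C *m D = 0 by apply: (DG0 _ B) => //; rewrite addrC.
apply/subr0_eq/mulmx_tr_eq0.
by rewrite -/D Dt {1}/D mulmxBl BD CD subrr.
Qed.

End Facts.

(* Main.v *)
Require Import Defs.
From mathcomp Require Import all_boot all_order all_algebra.
From mathcomp Require Import all_fingroup ring lra.
From mathcomp Require Import all_classical all_reals all_analysis.

Set Implicit Arguments.
Unset Strict Implicit.
Unset Printing Implicit Defensive.

Import Order.TTheory GRing.Theory Num.Theory.
Local Open Scope ring_scope.

(** Write J for the all-ones matrix, B for the square root of A = I + (beta/n) J
and C_f for the matrix whose columns are the basis vectors indexed by an
injection f. The expected projector M is the average over all f of the
projectors Q_f onto the range of B C_f.

Permuting the n coordinates commutes with B and permutes the set of injections,
so M is invariant under simultaneous permutations of rows and columns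
([perm_invariant_mx]) and therefore M = a I + b J for some a and b. Two linear
functionals determine a and b, and each of them takes the same value on every
Q_f, so that no entry of M ever has to be averaged:
- the trace of Q_f is its rank p ([mxtrace_sampled]), hence n (a + b) = p;
- the sum of the entries of Q_f is
  (1 + beta) p n / (n + beta p) ([ones_sampled]), hence n (a + n b) equals this
  number. Here the Gram matrix of B C_f is
  C_f^T A C_f = I + (beta/n) J in dimension p, whose inverse is explicit, and
  the all-ones vector is an eigenvector of B for sqrt (1 + beta).

Solving gives b = p beta (n - p) / (n (n + beta p) (n - 1)) >= 0. The
eigenvalues of a I + b J being a and a + n b, the smallest one is a
([lambda_min_idones]), and a = p/n - b is the announced value. *)

(** * The matrices a I + b J *)

Definition idones (R : pzRingType) (n : nat) (a b : R) : 'M[R]_n :=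
  a%:M + b *: const_mx 1.

Lemma mulmx_const1 (R : pzRingType) (m n p : nat) :
  (const_mx 1 : 'M[R]_(m, n)) *m (const_mx 1 : 'M[R]_(n, p)) =
  n%:R *: const_mx 1 :> 'M[R]_(m, p).
Proof.
apply/matrixP => i j; rewrite !mxE.
under eq_bigr do rewrite !mxE mulr1.
by rewrite sumr_const card_ord mulr1.
Qed.

Lemma mul_const1_idones (R : comPzRingType) (m n : nat) (a b : R) :
  const_mx 1 *m idones n a b = (a + n%:R * b) *: const_mx 1 :> 'M[R]_(m, n).
Proof.
rewrite mulmxDr -scalemxAr mulmx_const1 mul_mx_scalar scalerA -scalerDl.
by rewrite [b * _]mulrC.
Qed.

Lemma mul_idones (R : comPzRingType) (n : nat) (a b c d : R) :
  idones n a b *m idones n c d = idones n (a * c) (a * d + b * (c + n%:R * d)).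
Proof.
rewrite {1}/idones mulmxDl -scalemxAl mul_const1_idones mul_scalar_mx.
by rewrite /idones scalerDr scale_scalar_mx !scalerA -addrA -scalerDl.
Qed.

Lemma tr_idones (R : pzRingType) (n : nat) (a b : R) :
  (idones n a b)^T = idones n a b.
Proof. by rewrite /idones linearD linearZ /= tr_scalar_mx trmx_const. Qed.

Lemma mxtrace_idones (R : comPzRingType) (n : nat) (a b : R) :
  \tr (idones n a b) = n%:R * (a + b).
Proof.
rewrite /mxtrace; under eq_bigr do rewrite !mxE eqxx mulr1 mulr1n.
by rewrite sumr_const card_ord mulr_natl.
Qed.

Lemma perm_mx_idonesC (R : comPzRingType) (n : nat) (s : 'S_n) (a b : R) :
  perm_mx s *m idones n a b = idones n a b *m perm_mx s.
Proof.
rewrite mulmxDr mulmxDl -scalemxAr -scalemxAl scalar_mxC; congr (_ + _ *: _).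
rewrite -row_permE -[s in RHS]invgK -col_permE.
by apply/matrixP => i j; rewrite !mxE.
Qed.

(** The symmetric group acts doubly transitively on the indices, so an invariant
matrix has one value on the diagonal and one value off it. *)
Lemma perm_invariant_mx (R : pzRingType) (n : nat) (M : 'M[R]_n) :
  (1 < n)%N -> (forall (s : 'S_n) i j, M (s i) (s j) = M i j) ->
  exists a b, M = idones n a b.
Proof.
case: n M => [|[|n]] // M _ inv; pose i0 : 'I_n.+2 := ord0.
pose i1 : 'I_n.+2 := lift ord0 ord0.
exists (M i0 i0 - M i0 i1), (M i0 i1); apply/matrixP => i j.
rewrite !mxE mulr1; have [<-{j}|ij] := eqVneq i j.
  by rewrite mulr1n subrK -(inv (tperm i i0)) tpermL.
(* A permutation sending i0 to i and i1 to j: t sends i0 to i, and the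
   transposition of t i1 and j fixes i. *)
rewrite mulr0n add0r; pose t := tperm i0 i.
have ti0 : t i0 = i by rewrite tpermL.
have ti1 : t i1 != i by rewrite -ti0 (inj_eq perm_inj).
rewrite -[RHS](inv (t * tperm (t i1) j)%g) !permM ti0 tpermL tpermD //.
by rewrite eq_sym.
Qed.

Lemma idones_quad (R : comPzRingType) (n : nat) (a b : R) (v : 'rV[R]_n) :
  (v *m idones n a b *m v^T) 0 0 =
  a * (\sum_i v 0 i ^+ 2) + b * (\sum_i v 0 i) ^+ 2.
Proof.
have vJ i : (v *m const_mx 1 : 'rV[R]_n) 0 i = \sum_j v 0 j.
  by rewrite mxE; apply: eq_bigr => j _; rewrite mxE mulr1.
rewrite mulmxDr mul_mx_scalar -scalemxAr mxE expr2 mulrA mulr_sumr mulr_sumr.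
rewrite -big_split /=; apply: eq_bigr => i _.
by rewrite mxE [in X in _ + X]mxE vJ !mxE; ring.
Qed.

Lemma psd_idones (R : realType) (n : nat) (c : R) :
  0 <= c -> psd (idones n 1 c).
Proof.
move=> c0; split=> [|x]; first exact: tr_idones.
rewrite -{2}[x]trmxK idones_quad mul1r addr_ge0 ?(mulr_ge0 c0) ?sqr_ge0 //.
by apply: sumr_ge0 => i _; exact: sqr_ge0.
Qed.

Lemma A1_idones (R : realType) (n : nat) (beta : R) :
  A1 n beta = idones n 1 (beta / n%:R).
Proof.
by rewrite /A1 /ones trmx_const mulmx_const1 scale1r.
Qed.

(** The all-ones vector is an eigenvector of I + c J for 1 + n c; the
coefficient below is the c for which this eigenvalue is sqrt (1 + beta), the
square root of the corresponding eigenvalue of A. *)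
Lemma idones_sqrt (R : realType) (n : nat) (beta : R) :
  (0 < n)%N -> 0 < beta ->
  idones n 1 ((Num.sqrt (1 + beta) - 1) / n%:R) *m
  idones n 1 ((Num.sqrt (1 + beta) - 1) / n%:R) = A1 n beta.
Proof.
move=> n0 b0; have nn0 : n%:R != 0 :> R by rewrite pnatr_eq0 -lt0n.
have s2 : Num.sqrt (1 + beta) ^+ 2 = 1 + beta by rewrite sqr_sqrtr; lra.
rewrite A1_idones mul_idones mulr1; congr idones.
have -> : beta / n%:R = (Num.sqrt (1 + beta) ^+ 2 - 1) / n%:R.
  by rewrite s2 [1 + _]addrC addrK.
by field.
Qed.

Lemma psd_sqrt_A1 (R : realType) (n : nat) (beta : R) :
  (0 < n)%N -> 0 < beta ->
  psd_sqrt (A1 n beta) = idones n 1 ((Num.sqrt (1 + beta) - 1) / n%:R).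
Proof.
move=> n0 b0; have Bpsd : psd (idones n 1 ((Num.sqrt (1 + beta) - 1) / n%:R)).
  apply: psd_idones; rewrite divr_ge0 // subr_ge0 -{1}[1]sqrtr1 ler_sqrt; lra.
apply: xget_unique => [|C [Cpsd CC]]; first by split=> //; exact: idones_sqrt.
by apply: psd_sqrt_unique => //; rewrite CC idones_sqrt.
Qed.

(** The value a is attained on the hyperplane orthogonal to the all-ones vector,
which is nonzero as n > 1. It is minimal because the quadratic form of b J is a
nonnegative multiple of a square. *)
Lemma lambda_min_idones (R : realType) (n : nat) (a b : R) :
  (1 < n)%N -> 0 <= b -> lambda_min (idones n a b) = a.
Proof.
case: n => [|[|n]] // _ b0.
have ev : eigenvalue (idones n.+2 a b) a.
  apply/eigenvalueP.
  exists (delta_mx 0 0 - delta_mx 0 (lift 0 0)).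
    rewrite mulmxDr mul_mx_scalar -scalemxAr mulmxBl -!rowE !row_const.
    by rewrite subrr scaler0 addr0.
  apply/eqP => /matrixP /(_ 0 0); rewrite !mxE /= subr0 => /eqP.
  by rewrite oner_eq0.
have lb mu : eigenvalue (idones n.+2 a b) mu -> a <= mu.
  move=> /eigenvalueP[v vE vn0].
  have := idones_quad a b v; rewrite vE -scalemxAl mxE.
  have -> : (v *m v^T) 0 0 = \sum_i v 0 i ^+ 2.
    by rewrite mxE; apply: eq_bigr => i _; rewrite mxE expr2.
  have v2 : 0 < \sum_i v 0 i ^+ 2.
    rewrite lt_def sumr_ge0 ?andbT => [|i _]; last exact: sqr_ge0.
    apply: contraNneq vn0 => /psumr_eq0P v0; apply/eqP/rowP => i.
    rewrite mxE; apply/eqP; rewrite -sqrf_eq0 v0 // => j _; exact: sqr_ge0.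
  move=> muE; rewrite -(ler_pM2r v2) muE.
  by rewrite lerDl mulr_ge0 ?sqr_ge0.
apply: xget_unique => // c [evc lbc].
by apply/le_anti; rewrite lb // lbc.
Qed.

(** * Projectors and Gram matrices *)

(** The least-squares formula for the projector onto the range of a matrix with
independent columns. A left inverse W of the Gram matrix is a parameter, rather
than [invmx], so that an explicit inverse can be substituted at once. *)
Lemma orthoproj_gram (R : realType) (m n : nat) (M : 'M[R]_(m, n))
    (W : 'M[R]_n) :
  W *m (M^T *m M) = 1%:M -> orthoproj M = M *m W *m M^T.
Proof.
move=> WK; have [Qt QQ /eqmxP/andP[QM MQ]] := orthoprojP M.
move: Qt QQ QM MQ; set Q := orthoproj M => Qt QQ.
rewrite Qt => /submxP[Y QE] /submxP[X ME].
have MtQ : M^T *m Q = M^T by rewrite ME -mulmxA QQ.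
have QM : Q *m M = M by rewrite -{2}[M]trmxK -MtQ trmx_mul Qt trmxK.
have KW : M^T *m M *m W = 1%:M by apply: mulmx1C.
(* Evaluate Q M W M^T in two ways, with Q M = M and with Q = Y M^T. *)
transitivity (Q *m (M *m W *m M^T)); last by rewrite !mulmxA QM.
by rewrite {2}QE !mulmxA -[Y *m _ *m _]mulmxA -[Y *m _ *m _]mulmxA KW mulmx1.
Qed.

Lemma orthoproj_perm (R : realType) (m n : nat) (M : 'M[R]_(m, n))
    (W : 'M[R]_n) (s : 'S_m) :
  W *m (M^T *m M) = 1%:M ->
  orthoproj (perm_mx s *m M) = perm_mx s *m orthoproj M *m (perm_mx s)^T.
Proof.
move=> WK; rewrite (orthoproj_gram WK) (@orthoproj_gram _ _ _ _ W).
  by rewrite trmx_mul !mulmxA.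
rewrite trmx_mul -mulmxA [_^T *m (_ *m M)]mulmxA tr_perm_mx.
by rewrite -perm_mxM mulVg perm_mx1 mul1mx.
Qed.

(** * Column selections *)

Lemma tr_column_selection_mul (R : realType) (n p : nat)
    (f : {ffun 'I_p -> 'I_n}) :
  injective f ->
  (column_selection R f)^T *m column_selection R f = 1%:M.
Proof.
move=> injf; apply/matrixP => i j; rewrite !mxE (bigD1 (f i)) //= big1 => [|k].
  by rewrite !mxE !eqxx !andbT mul1r addr0 (inj_eq injf).
by rewrite !mxE => /negPf ->; rewrite mul0r.
Qed.

Lemma const1_column_selection (R : realType) (m n p : nat)
    (f : {ffun 'I_p -> 'I_n}) :
  const_mx 1 *m column_selection R f = const_mx 1 :> 'M[R]_(m, p).
Proof.
apply/matrixP => i j; rewrite !mxE (bigD1 (f j)) //= big1 => [|k].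
  by rewrite !mxE !eqxx mul1r addr0.
by rewrite !mxE => /negPf ->; rewrite mulr0.
Qed.

(** This makes the events indexed by distinct injections disjoint. *)
Lemma column_selection_inj (R : realType) (n p : nat) :
  injective (@column_selection R n p).
Proof.
move=> f g /matrixP fg; apply/ffunP => j.
have := fg (f j) j; rewrite !mxE !eqxx !andbT.
by case: eqP => // _ /eqP; rewrite oner_eq0.
Qed.

Lemma column_selection_perm (R : realType) (n p : nat) (s : 'S_n)
    (f : {ffun 'I_p -> 'I_n}) :
  perm_mx s *m column_selection R [ffun j => s (f j)] = column_selection R f.
Proof.
apply/matrixP => i j; rewrite -row_permE !mxE ffunE.
by rewrite (inj_eq perm_inj).
Qed.

(** Selecting columns cuts out a principal submatrix, and the principal
submatrices of a I + b J are again of this form. *)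
Lemma column_selection_idones (R : realType) (n p : nat)
    (f : {ffun 'I_p -> 'I_n}) (a b : R) :
  injective f ->
  (column_selection R f)^T *m idones n a b *m column_selection R f =
  idones p a b.
Proof.
move=> injf.
have CJ : (column_selection R f)^T *m const_mx 1 = const_mx 1 :> 'M[R]_(p, n).
  by rewrite -[LHS]trmxK trmx_mul trmxK trmx_const const1_column_selection
    trmx_const.
rewrite mulmxDr mulmxDl mul_mx_scalar -scalemxAl -scalemxAr -scalemxAl CJ.
rewrite const1_column_selection tr_column_selection_mul //.
by rewrite scalemx1.
Qed.

(** * Expectation over a uniform choice of columns *)

(** The random matrix F (S w) is the sum, over the injections f, of the constant
F (C_f) times the indicator of the event S = C_f. *)
Lemma expectation_mx_uniform (d : measure_display) (T : measurableType d)
    (R : realType) (P : probability T R) (m q n p : nat)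
    (S : T -> 'M[R]_(n, p)) (F : 'M[R]_(n, p) -> 'M[R]_(m, q)) :
  uniform_columns_without_replacement P S ->
  let inj := [set f : {ffun 'I_p -> 'I_n} | injectiveb f]%SET in
  expectation_mx P (fun w => F (S w)) =
  (#|inj|%:R)^-1 *: \sum_(f in inj) F (column_selection R f).
Proof.
move=> [Sval Sprob] inj; apply/matrixP => i j; rewrite !mxE summxE.
pose E f : set T := [set w | S w = column_selection R f]%classic.
pose X f : T -> R := F (column_selection R f) i j \o* \1_(E f).
have L1 f : f \in inj -> (\1_(E f) : T -> R) \in Lfun P 1.
  move=> /Sprob[mE _]; apply/Lfun1_integrable.
  exact: integrable_indic.
have -> : (fun w => F (S w) i j) = \sum_(Y <- map X (enum inj)) Y.
  apply/funext => w; rewrite big_map big_enum /= fct_sumE.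
  have [f fi Sf] := Sval w; rewrite (bigD1 f) //= big1 => [|g /andP[_ gf]].
    by rewrite /X /= indicE mem_set // mul1r addr0 Sf.
  rewrite /X /= indicE memNset ?mul0r // /E /= Sf => /column_selection_inj fg.
  by rewrite fg eqxx in gf.
rewrite expectation_sum => [|Y /mapP[f]]; last first.
  rewrite mem_enum => fi ->.
  apply/Lfun1_integrable.
  have /Lfun1_integrable L := L1 f fi.
  apply: eq_integrable (integrableZr _ (F (column_selection R f) i j) L) => //.
rewrite big_map big_enum /= (eq_bigr (fun f =>
  ((#|inj|%:R)^-1 * F (column_selection R f) i j)%:E)) => [|f fi].
  by rewrite sumEFin /= mulr_sumr.
have [mE PE] := Sprob f fi.
rewrite /X expectationZl; last exact: L1.
by rewrite expectation_indic // PE -EFinM mulrC.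
Qed.

(** * The projectors for a fixed choice of columns *)

Section SampledProjector.
Variables (R : realType) (beta : R) (n p : nat).
Hypotheses (beta_gt0 : 0 < beta) (n_gt0 : (0 < n)%N).

Let B : 'M[R]_n := psd_sqrt (A1 n beta).
Let W : 'M[R]_p := idones p 1 (- (beta / (n%:R + beta * p%:R))).
Let C f : 'M[R]_(n, p) := column_selection R f.

Let nR0 : 0 < n%:R :> R. Proof. by rewrite ltr0n. Qed.
Let den0 : 0 < n%:R + beta * p%:R.
Proof. by rewrite ltr_wpDr // mulr_ge0 // ltW. Qed.

Let BE : B = idones n 1 ((Num.sqrt (1 + beta) - 1) / n%:R).
Proof. exact: psd_sqrt_A1. Qed.

Let Bt : B^T = B. Proof. by rewrite BE tr_idones. Qed.

Let BB : B *m B = A1 n beta.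
Proof. by rewrite BE idones_sqrt. Qed.

(** W is the Sherman-Morrison inverse of the Gram matrix I + (beta/n) J. *)
Lemma sampled_gram_inv (f : {ffun 'I_p -> 'I_n}) :
  injective f -> W *m ((B *m C f)^T *m (B *m C f)) = 1%:M.
Proof.
move=> injf; rewrite trmx_mul Bt -mulmxA [B *m (B *m _)]mulmxA BB A1_idones.
rewrite [_^T *m (_ *m _)]mulmxA column_selection_idones // mul_idones.
rewrite (_ : _ + _ = 0 :> R); last by field; rewrite !gt_eqF.
by rewrite /idones scale0r addr0 mulr1.
Qed.

(** By cyclicity the trace of (B C) W (B C)^T is that of the p by p identity. *)
Lemma mxtrace_sampled (f : {ffun 'I_p -> 'I_n}) :
  injective f -> \tr (orthoproj (B *m C f)) = p%:R.
Proof.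
move=> injf; have WK := sampled_gram_inv injf.
by rewrite (orthoproj_gram WK) mxtrace_mulC mulmxA (mulmx1C WK) mxtrace1.
Qed.

(** The left-hand side is the sum of the entries of the projector. As the row of
ones is multiplied by sqrt (1 + beta) under B and restricts to the row of ones
under column selection, what remains is (1 + beta) times the sum of the entries
of the inverse Gram matrix W. *)
Lemma ones_sampled (f : {ffun 'I_p -> 'I_n}) :
  injective f ->
  const_mx 1 *m orthoproj (B *m C f) *m const_mx 1 =
  ((1 + beta) * (p%:R * n%:R / (n%:R + beta * p%:R)))%:M :> 'M[R]_1.
Proof.
move=> injf; rewrite (orthoproj_gram (sampled_gram_inv injf)).
pose r : R := Num.sqrt (1 + beta).
have r2 : r ^+ 2 = 1 + beta by rewrite sqr_sqrtr // addr_ge0 // ltW.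
have oneB : const_mx 1 *m (B *m C f) = r *: const_mx 1 :> 'M[R]_(1, p).
  rewrite mulmxA BE mul_const1_idones -scalemxAl const1_column_selection.
  by congr (_ *: _); rewrite /r; field; rewrite gt_eqF.
rewrite !mulmxA -[const_mx 1 *m B *m _]mulmxA oneB -mulmxA.
rewrite -[X in _ *m X]trmxK trmx_mul trmxK trmx_const oneB.
rewrite linearZ /= trmx_const.
rewrite -scalemxAl mul_const1_idones -!(scalemxAl, scalemxAr) mulmx_const1.
rewrite !scalerA -r2; apply/matrixP => i j; rewrite !ord1 !mxE /= mulr1n mulr1.
by field; rewrite gt_eqF.
Qed.

(** Since permutation matrices commute with B, relabelling the chosen columns
conjugates the projector. *)
Lemma sampled_perm (f : {ffun 'I_p -> 'I_n}) (s : 'S_n) i j :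
  injective f ->
  orthoproj (B *m C [ffun k => s (f k)]) (s i) (s j) =
  orthoproj (B *m C f) i j.
Proof.
move=> injf.
have injsf : injective [ffun k => s (f k)].
  by move=> k l; rewrite !ffunE => /perm_inj /injf.
rewrite /C -(column_selection_perm R s f) mulmxA BE -perm_mx_idonesC -mulmxA.
rewrite -BE (orthoproj_perm s (sampled_gram_inv injsf)).
rewrite tr_perm_mx -row_permE -col_permE.
by rewrite !mxE.
Qed.

End SampledProjector.

(** * The smallest eigenvalue of the expected projector *)

Theorem proposition3p2 (R : realType) (beta : R) (hbeta : 0 < beta)
    (n p : nat) (hp : (1 < p)%N) (hpn : (p < n)%N)
    (d : measure_display) (T : measurableType d) (P : probability T R)
    (S : T -> 'M[R]_(n, p))
    (hS : uniform_columns_without_replacement P S) :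
  lambda_min
    (expectation_mx P (fun w => orthoproj (psd_sqrt (A1 n beta) *m S w))) =
  p%:R / (n%:R + beta * p%:R) +
  (p%:R - 1) * beta * p%:R / ((n%:R - 1) * (n%:R + beta * p%:R)).
Proof.
have n_gt1 : (1 < n)%N by exact: ltn_trans hpn.
have n_gt0 : (0 < n)%N by exact: ltnW.
rewrite (expectation_mx_uniform
  (fun X => orthoproj (psd_sqrt (A1 n beta) *m X)) hS) /=.
set inj := [set f | _]%SET.
set M := _ *: _.
have injP f : f \in inj -> injective f by rewrite inE => /injectiveP.
have N0 : #|inj|%:R != 0 :> R.
  by rewrite pnatr_eq0 -lt0n card_inj_ffuns !card_ord ffact_gt0 ltnW.
have trM : \tr M = p%:R.
  rewrite /M mxtraceZ raddf_sum /= (eq_bigr (fun=> p%:R)) => [|f /injP].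
    by rewrite sumr_const -[_ *+ #|_|]mulr_natl mulKf.
  exact: mxtrace_sampled.
pose e := (1 + beta) * (p%:R * n%:R / (n%:R + beta * p%:R)).
have oneM : const_mx 1 *m M *m const_mx 1 = e%:M :> 'M[R]_1.
  rewrite /M -scalemxAr -scalemxAl mulmx_sumr mulmx_suml.
  rewrite (eq_bigr (fun=> e%:M)) => [|f /injP fi]; last exact: ones_sampled.
  by rewrite sumr_const -[e%:M *+ _]scaler_nat scalerA mulVf // scale1r.
(* Composing with s permutes the injections, which reindexes the average. *)
have [a [b ME]] : exists a b, M = idones n a b.
  apply: perm_invariant_mx => // s i j; rewrite /M !mxE !summxE; congr (_ * _).
  pose h (f : {ffun 'I_p -> 'I_n}) := [ffun k => s (f k)].
  have hinj : injective h.
    move=> f g /ffunP fg; apply/ffunP => k.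
    by have := fg k; rewrite !ffunE => /perm_inj.
  have hin f : (h f \in inj) = (f \in inj).
    rewrite !inE; apply/injectiveP/injectiveP => fi k l.
      by move=> fkl; apply: fi; rewrite !ffunE fkl.
    by rewrite !ffunE => /perm_inj /fi.
  rewrite (reindex_inj hinj) /= (eq_bigl _ _ hin); apply: eq_bigr => f /injP.
  exact: sampled_perm.
rewrite ME.
have nR : 1 < n%:R :> R by rewrite ltr1n.
have pR : 1 < p%:R :> R by rewrite ltr1n.
have pnR : p%:R < n%:R :> R by rewrite ltr_nat.
have tr_eq : n%:R * (a + b) = p%:R by rewrite -trM ME mxtrace_idones.
have ones_eq : n%:R * (a + n%:R * b) = e.
  move/matrixP: oneM => /(_ 0 0); rewrite ME mul_const1_idones -scalemxAl.
  by rewrite mulmx_const1 !mxE mulr1 mulr1n mulrC.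
have den0 : 0 < n%:R + beta * p%:R by nra.
have bE : b = p%:R * beta * (n%:R - p%:R) /
    ((n%:R + beta * p%:R) * n%:R * (n%:R - 1)).
  have -> : b = (e - p%:R) / (n%:R * (n%:R - 1)).
    by rewrite -ones_eq -tr_eq; field; apply/andP; split; lra.
  by rewrite /e; field; apply/and3P; split; lra.
rewrite lambda_min_idones //; last first.
  by rewrite bE divr_ge0 // ?mulr_ge0 //; lra.
have -> : a = p%:R / n%:R - b by rewrite -tr_eq; field; lra.
by rewrite bE; field; apply/and3P; split; lra.
Qed.
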